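(* Let $X$ be an arbitrary subset of $\omega$, and let $A=(a_{nk})_{n,k\ge1}$ and $E=(e_{nk})_{n,k\ge1}$ be infinite matrices with $$e_{nk}=\sum_{j=1}^n j\,a_{jk}\qquad\text{for all } n,k\in\mathbb{N}.$$ Then: (i) $A\in(X:c_0(\Omega))$ if and only if $E\in(X:c_0)$. (ii) $A\in(X:c(\Omega))$ if and only if $E\in(X:c)$. (iii) $A\in(X:\ell_\infty(\Omega))$ if and only if $E\in(X:\ell_\infty)$.
   Context: $\omega$ is the space of all real (or complex) sequences $x=(x_k)_{k\ge1}$; $\ell_\infty$, $c$, $c_0$ are the spaces of bounded, convergent and null sequences. The infinite matrix $\Omega=(\omega_{nk})_{n,k\ge1}$ has $\omega_{nk}=k$ for $1\le k\le n$ and $\omega_{nk}=0$ for $k>n$, so $(\Omega x)_n=\sum_{k=1}^n kx_k$, and for $Z\in\{\ell_\infty,c,c_0\}$, $Z(\Omega)=\{x\in\omega:\Omega x\in Z\}$. $(X:Y)$ denotes the class of infinite matrices $A=(a_{nk})$ such that for every $x\in X$ the series $(Ax)_n=\sum_k a_{nk}x_k$ converges for every $n$ and $Ax=((Ax)_n)_n\in Y$. *)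

(* Defs.v *)
From mathcomp Require Import all_boot all_order all_algebra.
From mathcomp Require Import all_classical all_reals all_analysis.
From mathcomp Require Import complex.
Set Implicit Arguments.
Unset Strict Implicit.
Unset Printing Implicit Defensive.
Import Order.TTheory GRing.Theory Num.Theory.
Import numFieldNormedType.Exports.
Local Open Scope classical_set_scope.
Local Open Scope ring_scope.

(* The scalar field is either the reals or the complex numbers. *)
Inductive real_or_complex (R : realType) : numFieldType -> Prop :=
| scalar_real : real_or_complex R R
| scalar_complex : real_or_complex R R[i]%C.

Section SequenceSpaces.
Variable K : numFieldType.

(* The mathematical indices start at 1, the Rocq ones at 0: [x k] stands for
   x_(k+1) and [A n k] for a_(n+1, k+1). *)
Definition omega : Type := nat -> K.
Definition infmatrix : Type := nat -> nat -> K.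

Definition ell_infty : set omega := [set x | bounded_fun x].
Definition c_space : set omega := [set x | cvgn x].
Definition c0_space : set omega := [set x | x @ \oo --> (0 : K)].

Definition row_series (A : infmatrix) (x : omega) (n : nat) : nat -> K :=
  series (fun k => A n k * x k).

Definition transformable (A : infmatrix) (x : omega) : Prop :=
  forall n, cvgn (row_series A x n).

(* Only meaningful when [transformable A x], [limn] being total. *)
Definition transform (A : infmatrix) (x : omega) : omega :=
  fun n => limn (row_series A x n).

Definition matrix_class (X Y : set omega) : set infmatrix :=
  [set A | forall x, X x -> transformable A x /\ Y (transform A x)].

Definition matrix_domain (Z : set omega) (B : infmatrix) : set omega :=
  [set x | transformable B x /\ Z (transform B x)].

Definition Omega : infmatrix :=
  fun n k => if (k <= n)%N then k.+1%:R else 0.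

(* The rows of [Omega] are finitely supported, so the convergence condition in
   [matrix_domain Z Omega] is vacuous and the transform is a finite sum. *)
Lemma cvg_row_series_Omega (x : omega) (n : nat) :
  row_series Omega x n @ \oo --> \sum_(k < n.+1) k.+1%:R * x k.
Proof.
apply: cvg_near_cst; exists n.+1 => //= m /= nm.
rewrite /row_series /series /= (@big_cat_nat _ _ _ n.+1)//= [X in _ + X]big1_seq ?addr0.
  by rewrite big_mkord; apply: eq_bigr => k _; rewrite /Omega -ltnS ltn_ord.
move=> k /=; rewrite mem_index_iota => /andP[nk _].
by rewrite /Omega leqNgt nk mul0r.
Qed.

Lemma transformable_Omega (x : omega) : transformable Omega x.
Proof. by move=> n; apply/cvg_ex; eexists; exact: cvg_row_series_Omega. Qed.

Lemma transform_Omega (x : omega) (n : nat) :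
  transform Omega x n = \sum_(k < n.+1) k.+1%:R * x k.
Proof. exact/cvg_lim/cvg_row_series_Omega. Qed.

End SequenceSpaces.
Arguments Omega {K}.

(* Main.v *)
(* With S_n m the m-th partial sum of the n-th row series of A at x, the one of
   E is \sum_(j <= n) (j+1) S_j m, a finite combination that can be inverted
   since (n+1) S_n is a difference of two consecutive rows of E.  Hence all the
   row series of A converge iff all those of E do, and then E x = Omega (A x);
   nothing depends on the target space. *)
Require Import Defs.
From mathcomp Require Import all_boot all_order all_algebra.
From mathcomp Require Import all_classical all_reals all_analysis.
Import GRing.Theory Num.Theory numFieldNormedType.Exports.
Local Open Scope classical_set_scope.
Local Open Scope ring_scope.

(** The matrix product of [Omega] and [A]; [Omega] is lower triangular, so each entry is a finite
    sum. *)
Definition weighted_row_sums {K : numFieldType} (A : infmatrix K) :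
  infmatrix K :=
  fun n k => \sum_(j < n.+1) j.+1%:R * A j k.

Lemma row_series_weighted_row_sums (K : numFieldType) (A : infmatrix K)
    (x : omega K) (n m : nat) :
  row_series (weighted_row_sums A) x n m =
  \sum_(j < n.+1) j.+1%:R * row_series A x j m.
Proof.
under [RHS]eq_bigr do rewrite mulr_sumr.
rewrite exchange_big /=; apply: eq_bigr => k _.
by rewrite mulr_suml; apply: eq_bigr => j _; rewrite mulrA.
Qed.

(** The number n+1 of summands does not depend on m, so the limit in m passes through the sum. *)
Lemma cvg_row_series_weighted_row_sums (K : numFieldType) (A : infmatrix K)
    (x : omega K) (n : nat) :
  transformable A x ->
  row_series (weighted_row_sums A) x n @ \oo -->
  transform Omega (transform A x) n.
Proof.
move=> Ax; rewrite transform_Omega.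
rewrite (funext (row_series_weighted_row_sums _ A x n)).
apply: cvg_big => [|j _]; first exact: add_continuous.
by apply: cvgM; [exact: cvg_cst|exact: Ax].
Qed.

Lemma transformable_weighted_row_sums (K : numFieldType) (A : infmatrix K)
    (x : omega K) :
  transformable (weighted_row_sums A) x <-> transformable A x.
Proof.
split=> [Ex|Ax n]; last first.
  by apply/cvg_ex; eexists; exact: cvg_row_series_weighted_row_sums.
(* The weight n+1 is nonzero in [K], so it can be divided out. *)
suff Sx n : cvgn (fun m => n.+1%:R * row_series A x n m).
  move=> n; rewrite (_ : row_series A x n =
      (fun=> n.+1%:R^-1) \* (fun m => n.+1%:R * row_series A x n m)).
    by apply: is_cvgM (Sx n); exact: is_cvg_cst.
  by apply/funext => m; rewrite /= mulKf// pnatr_eq0.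
(* The first row has no predecessor to subtract, but its weight is 1, so both matrices share it. *)
case: n => [|n].
  rewrite (_ : (fun m => _) = row_series (weighted_row_sums A) x 0).
    exact: Ex.
  by apply/funext => m; rewrite row_series_weighted_row_sums big_ord1.
rewrite (_ : (fun m => _) = row_series (weighted_row_sums A) x n.+1 -
                            row_series (weighted_row_sums A) x n).
  by apply: is_cvgB; exact: Ex.
apply/funext => m; rewrite !fctE !row_series_weighted_row_sums.
by rewrite big_ord_recr /= addrC addKr.
Qed.

Lemma matrix_class_domain_Omega (K : numFieldType) (X Z : set (omega K))
    (A : infmatrix K) :
  matrix_class X (matrix_domain Z Omega) A <->
  matrix_class X Z (weighted_row_sums A).
Proof.
(* Without convergence of the row series of [A], [limn] may return default values, so the identity
   is claimed only under that condition. *)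
have trE x : transformable A x ->
    transform (weighted_row_sums A) x = transform Omega (transform A x).
  move=> Ax; apply/funext => n.
  by apply/cvg_lim => //; exact: cvg_row_series_weighted_row_sums.
split=> AX x /AX.
- move=> [Ax [_ Zx]]; rewrite trE//; split=> //.
  exact/transformable_weighted_row_sums.
(* Convergence for [A] is recovered first, since [trE] depends on it. *)
- move=> [/transformable_weighted_row_sums Ax]; rewrite trE// => Zx.
  by split=> //; split=> //; exact: transformable_Omega.
Qed.

Theorem theorem4p2 (R : realType) (K : numFieldType)
    (hK : real_or_complex R K)
    (X : set (omega K)) (A E : infmatrix K)
    (hE : forall n k : nat, E n k = \sum_(j < n.+1) j.+1%:R * A j k) :
  (matrix_class X (matrix_domain (@c0_space K) Omega) A <->
     matrix_class X (@c0_space K) E) /\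
  (matrix_class X (matrix_domain (@c_space K) Omega) A <->
     matrix_class X (@c_space K) E) /\
  (matrix_class X (matrix_domain (@ell_infty K) Omega) A <->
     matrix_class X (@ell_infty K) E).
Proof.
have -> : E = weighted_row_sums A.
  by apply/funext => n; apply/funext => k; exact: hE.
by split; last split; exact: matrix_class_domain_Omega.
Qed.
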